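(* Let $T$ be a tree. Then (1) every maximum dissociation set of $T$ contains at least one end-vertex of each $\alpha_3$-critical edge of $T$; (2) a vertex of $T$ is flexible if and only if it is an end-vertex of an $\alpha_3$-critical edge of $T$.
   Context: A dissociation set of a graph $G$ is a set $S$ of vertices such that $G[S]$ has maximum degree at most $1$; a maximum dissociation set is one of maximum cardinality, which is denoted $\alpha_3(G)$. An edge $e$ is $\alpha_3$-critical if $\alpha_3(G-e)>\alpha_3(G)$, where $G-e$ is obtained by deleting $e$. A vertex is flexible if it belongs to some but not all maximum dissociation sets of $G$. *)

(* Defs.v *)
From mathcomp Require Import all_boot.

Set Implicit Arguments.
Unset Strict Implicit.
Unset Printing Implicit Defensive.

(* A finite simple graph is a symmetric irreflexive relation on a finType. *)

Section Dissociation.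
Variable T : finType.
Implicit Types (e : rel T) (S : {set T}) (u v x y : T).

Definition simple_graph e : Prop := symmetric e /\ irreflexive e.

Definition connected_graph e : Prop :=
  0 < #|T| /\ forall x y, connect e x y.

(* ucycle also holds of the empty sequence and of sequences x :: y :: nil
   with x adjacent to y, hence the bound 2. *)
Definition acyclic_graph e : Prop :=
  forall c : seq T, ucycle e c -> size c <= 2.

Definition is_tree e : Prop :=
  [/\ simple_graph e, connected_graph e & acyclic_graph e].

Definition induced_degree e S x : nat := #|[set y in S | e x y]|.

Definition dissociation_set e S : bool :=
  [forall x in S, induced_degree e S x <= 1].

Definition alpha3 e : nat := \max_(S : {set T} | dissociation_set e S) #|S|.

Definition max_dissociation_set e S : bool :=
  dissociation_set e S && (#|S| == alpha3 e).

Definition delete_edge e u v : rel T :=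
  [rel x y | e x y && ([set x; y] != [set u; v])].

Definition critical_edge e u v : bool :=
  e u v && (alpha3 e < alpha3 (delete_edge e u v)).

Definition flexible e v : Prop :=
  (exists2 S, max_dissociation_set e S & v \in S) /\
  (exists2 S, max_dissociation_set e S & v \notin S).

End Dissociation.

(* Main.v *)
(** If [e v u] is an edge of a tree, the branch [C] of [T - v] containing [u] is
    joined to its complement by the edge [vu] only. Hence, for dissociation sets
    [A] and [B] of [T - vu], the exchange [(A :&: C) :|: (B :\: C)] is again a
    dissociation set of [T - vu]. If a maximum dissociation set avoided both ends
    of a critical edge, exchanging it with a larger dissociation set of [T - vu] on
    one side of the edge would enlarge it within [T]. If [S] and [S'] are maximum
    with [v] in [S] only, then [S'] exceeds [S] on some branch of [T - v], and
    exchanging [S] for [S'] on that branch shows that its edge to [v] is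
    critical. Conversely, a maximum dissociation set of [T - vu], for [vu]
    critical, contains both ends, and removing either one leaves a maximum
    dissociation set of [T]. *)
Require Import Defs.
From mathcomp Require Import all_boot.

Section DissociationSets.
Set Implicit Arguments.
Unset Strict Implicit.
Variable T : finType.
Implicit Types (e : rel T) (A B C S : {set T}) (u v x y : T).

Lemma dissociation_set_mono e1 e2 A B :
  A \subset B -> {in A &, subrel e1 e2} ->
  dissociation_set e2 B -> dissociation_set e1 A.
Proof.
move=> /subsetP sAB sub12 /forall_inP dB; apply/forall_inP=> x xA.
apply: leq_trans (dB x (sAB x xA)); apply/subset_leq_card/subsetP=> y.
by rewrite !inE => /andP[yA exy]; rewrite sAB // sub12.
Qed.

(** No edge joins [C] to its complement, so a vertex of the new set has its neighbours there within
    [A] or within [B] only, according to its own side of [C]. *)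
Lemma dissociation_set_exchange e A B C :
  symmetric e -> {in C & ~: C, forall x y, ~~ e x y} ->
  dissociation_set e A -> dissociation_set e B ->
  dissociation_set e ((A :&: C) :|: (B :\: C)).
Proof.
move=> sym_e noC /forall_inP dA /forall_inP dB; apply/forall_inP=> x.
rewrite !inE => /orP[/andP[xA xC] | /andP[xC xB]].
  apply: leq_trans (dA x xA); apply/subset_leq_card/subsetP=> y.
  rewrite !inE => /andP[/orP[/andP[-> _] -> // | /andP[yC _]]].
  by rewrite (negPf (noC x y xC _)) ?inE.
apply: leq_trans (dB x xB); apply/subset_leq_card/subsetP=> y.
rewrite !inE => /andP[/orP[/andP[_ yC] | /andP[_ ->] -> //]].
by rewrite sym_e (negPf (noC y x yC _)) ?inE.
Qed.

Lemma card_exchange A B C :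
  #|(A :&: C) :|: (B :\: C)| = #|A :&: C| + #|B :\: C|.
Proof.
apply/eqP; rewrite (leq_card_setU (A :&: C) (B :\: C)).2 -setI_eq0.
by apply/eqP/setP=> x; rewrite !inE; case: (x \in C); rewrite ?andbF.
Qed.

Lemma leq_alpha3 e S : dissociation_set e S -> #|S| <= alpha3 e.
Proof. exact: (@leq_bigmax_cond _ (dissociation_set e) (fun A => #|A|)). Qed.

Lemma alpha3_witness e :
  exists2 S, dissociation_set e S & #|S| = alpha3 e.
Proof.
have n0 : 0 < #|dissociation_set e|.
  by apply/card_gt0P; exists set0; apply/forall_inP=> x; rewrite inE.
by have [S dS] := eq_bigmax_cond (fun A => #|A|) n0; exists S.
Qed.

Lemma delete_edge_sym e u v : symmetric e -> symmetric (delete_edge e u v).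
Proof. by move=> sym_e x y; rewrite /delete_edge /= sym_e [[set x; y]]setUC. Qed.

Lemma dissociation_set_delete e u v S :
  dissociation_set e S -> dissociation_set (delete_edge e u v) S.
Proof. by apply: dissociation_set_mono => // x y _ _ /andP[]. Qed.

Lemma dissociation_set_undelete e u v S :
  ~~ ((u \in S) && (v \in S)) ->
  dissociation_set (delete_edge e u v) S -> dissociation_set e S.
Proof.
move=> uvS; apply: dissociation_set_mono => // x y xS yS.
rewrite /delete_edge /= => ->.
apply: contra uvS => /eqP/setP eq_xy.
have subS z : z \in [set u; v] -> z \in S.
  by rewrite -eq_xy !inE => /orP[]/eqP->.
by rewrite !subS ?inE ?eqxx ?orbT.
Qed.

Lemma critical_edge_flexible e u v :
  irreflexive e -> critical_edge e u v -> flexible e u.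
Proof.
move=> irr_e /andP[e_uv lt_alpha].
have neq_uv : u != v by apply: contraTneq e_uv => ->; rewrite irr_e.
have [S dS cS] := alpha3_witness (delete_edge e u v).
(* Otherwise [S] would be a dissociation set of [e] itself, too large for [alpha3 e]. *)
have /andP[uS vS] : (u \in S) && (v \in S).
  apply: contraLR lt_alpha => uvS.
  by rewrite -leqNgt -cS leq_alpha3 // (dissociation_set_undelete uvS).
have max_S w : w \in S -> ~~ ((u \in S :\ w) && (v \in S :\ w)) ->
    max_dissociation_set e (S :\ w).
  move=> wS uvSw; have dSw : dissociation_set e (S :\ w).
    by apply: dissociation_set_undelete uvSw (dissociation_set_mono _ _ dS);
      rewrite ?subsetDl.
  (* [#|S|] exceeds [alpha3 e], so losing one vertex still leaves at least [alpha3 e]. *)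
  rewrite /max_dissociation_set dSw eqn_leq leq_alpha3 //=.
  by rewrite -ltnS (leq_trans lt_alpha) // -cS (cardsD1 w S) wS.
split; [exists (S :\ v) | exists (S :\ u)].
- by apply: max_S; rewrite // !inE eqxx andbF.
- by rewrite !inE neq_uv.
- by apply: max_S; rewrite // !inE eqxx.
- by rewrite !inE eqxx.
Qed.

End DissociationSets.

Section Branches.
Set Implicit Arguments.
Unset Strict Implicit.
Variables (T : finType) (e : rel T).
Hypotheses (sym_e : symmetric e) (irr_e : irreflexive e) (acyc_e : acyclic_graph e).
Implicit Types (A B C S : {set T}) (u v x y : T).

(** Deletion of the vertex [v] without changing the vertex type: [v] becomes isolated. *)
Definition avoiding v : rel T := [rel x y | [&& e x y, x != v & y != v]].

Definition branch v u : {set T} := [set x | connect (avoiding v) u x].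

Lemma avoiding_connect_sym v : connect_sym (avoiding v).
Proof.
by apply: sym_connect_sym => x y; rewrite /avoiding /= sym_e [(x != v) && _]andbC.
Qed.

Lemma avoiding_path v x p : path (avoiding v) x p -> path e x p /\ v \notin p.
Proof.
elim: p x => //= y p IHp x /andP[/and3P[-> _ yv] /IHp[-> vp]].
by rewrite inE negb_or eq_sym yv.
Qed.

Lemma notin_branch v u : e v u -> v \notin branch v u.
Proof.
move=> e_vu; have uv : u != v by apply: contraTneq e_vu => ->; rewrite irr_e.
rewrite inE; apply/connectP=> -[p /avoiding_path[_ vp] def_v].
by move: (mem_last u p); rewrite -def_v inE eq_sym (negPf uv) (negPf vp).
Qed.

(** If [y] were not [v], the edge [xy] would put it in the branch. If [x] were not [u], a simple
    path from [u] to [x] avoiding [v] would close up through [v] into a cycle. *)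
Lemma branch_cut v u x y :
  e v u -> x \in branch v u -> y \notin branch v u -> e x y ->
  x = u /\ y = v.
Proof.
move=> e_vu xC yC e_xy.
have uv : u != v by apply: contraTneq e_vu => ->; rewrite irr_e.
have xv : x != v by apply: contraTneq xC => ->; apply: notin_branch.
have def_y : y = v.
  apply: contraNeq yC => yv; move: xC; rewrite !inE => /connect_trans; apply.
  by apply: connect1; rewrite /avoiding /= e_xy xv.
split=> //; move: xC; rewrite inE => /connectP[p0 p0P].
case/shortenP: p0P => p pP up _ def_x; have [ep vp] := avoiding_path pP.
have: ucycle e [:: v, u & p].
  rewrite /ucycle /= e_vu rcons_path ep -def_x -def_y e_xy /=.
  by rewrite def_y inE negb_or eq_sym uv vp -/(uniq (u :: p)).
(* The size bound 2 forces [p] to be empty, whence [x = u]. *)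
by move/acyc_e; case: p def_x {pP up ep vp}.
Qed.

(** On a path from [x] to [v], the vertex just before the first visit to [v] serves as [u]. *)
Lemma branch_cover v x :
  connect e x v -> x != v -> exists2 u, e v u & x \in branch v u.
Proof.
move=> /connectP[p]; elim: p x => [|y p IHp] x /=.
  by move=> _ ->; rewrite eqxx.
move=> /andP[e_xy ep] def_v xv; case: (eqVneq y v) => [eq_yv | yv].
  by exists x; rewrite ?inE ?connect0 // sym_e -eq_yv.
have [u e_vu] := IHp y ep def_v yv; rewrite inE => u_y.
exists u; rewrite // inE (connect_trans u_y) // avoiding_connect_sym.
by apply: connect1; rewrite /avoiding /= e_xy xv.
Qed.

Lemma delete_edge_branch v u :
  e v u ->
  {in branch v u & ~: branch v u, forall x y, ~~ delete_edge e v u x y}.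
Proof.
move=> e_vu x y xC; rewrite inE => yC.
apply/negP=> /andP[e_xy]; have [-> ->] := branch_cut e_vu xC yC e_xy.
by rewrite setUC eqxx.
Qed.

Lemma branch_pigeonhole v A B :
  (forall x, connect e x v) -> #|A| <= #|B| -> v \in A -> v \notin B ->
  exists2 u, e v u & #|A :&: branch v u| < #|B :&: branch v u|.
Proof.
(* Roots index the components of [avoiding v], so every set splits along them; non-roots contribute
   0 to the sum. *)
move=> conn_e leAB vA vB; pose r := root (avoiding v).
have card_root S : #|S| = \sum_x #|[set y in S | r y == x]|.
  rewrite -sum1_card (partition_big r predT) //=.
  by apply: eq_bigr => x _; rewrite -sum1_card; apply: eq_bigl => y; rewrite inE.
have eq_root x y : (r y == r x) = connect (avoiding v) x y.
  by rewrite eq_sym root_connect //; apply: avoiding_connect_sym.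
(* Dropping [v] makes the comparison strict: [A :\ v] is smaller than [B], so some component holds
   more of [B]. *)
have [z ltAB]: exists z,
    #|[set y in A :\ v | r y == z]| < #|[set y in B | r y == z]|.
  apply/existsP; apply: contraLR leAB => /existsPn leBA.
  rewrite -ltnNge (cardsD1 v A) vA ltnS (card_root B) (card_root (A :\ v)).
  by apply: leq_sum => z _; rewrite leqNgt.
(* This component contains some [x] of [B], which differs from [v]; hence it is a branch. *)
have /card_gt0P[x] := leq_ltn_trans (leq0n _) ltAB.
rewrite inE => /andP[xB /eqP def_z].
have xv : x != v by apply: contraNneq vB => <-.
have [u e_vu xC] := branch_cover (conn_e x) xv; exists u => //.
have uC y : (y \in branch v u) = (r y == z).
  rewrite inE in xC; rewrite inE -def_z eq_root.
  by apply: (same_connect (@avoiding_connect_sym v) xC).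
have restr S : [set y in S | r y == z] = S :&: branch v u.
  by apply/setP=> y; rewrite in_setI uC inE.
move: ltAB; rewrite !restr setIDAC (setDidPl _) //.
by rewrite disjoint_sym disjoints1 inE negb_and notin_branch ?orbT.
Qed.

End Branches.

Theorem theorem3p5 (T : finType) (e : rel T) (tree_e : is_tree e) :
  (forall (S : {set T}) (u v : T),
     max_dissociation_set e S -> critical_edge e u v ->
     u \in S \/ v \in S) /\
  (forall v : T, flexible e v <-> exists u : T, critical_edge e v u).
Proof.
have [[sym_e irr_e] [_ conn_e] acyc_e] := tree_e.
have exch v u A B : e v u ->
    dissociation_set (delete_edge e v u) A ->
    dissociation_set (delete_edge e v u) B ->
    dissociation_set (delete_edge e v u)
      ((A :&: branch e v u) :|: (B :\: branch e v u)).
  move=> e_vu; apply: dissociation_set_exchange.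
    exact: delete_edge_sym.
  exact: delete_edge_branch.
split=> [S v u /andP[dS /eqP cS] /andP[e_vu lt_alpha] | v].
  apply/orP; apply: contraLR lt_alpha; rewrite negb_or -leqNgt => /andP[vS uS].
  have [S' dS' <-] := alpha3_witness (delete_edge e v u).
  have dS0 := dissociation_set_delete v u dS.
  have vC : v \notin branch e v u by apply: notin_branch.
  have uC : u \in branch e v u by rewrite inE connect0.
  (* Each exchange takes one end of the edge from [S], hence misses it and is a dissociation set of
     [e]. Maximality of [S] bounds [S'] by [S] inside the branch and outside it. *)
  have := exch v u S' S e_vu dS' dS0; have := exch v u S S' e_vu dS0 dS'.
  move=> /dissociation_set_undelete dout /dissociation_set_undelete din.
  have:= leq_alpha3 (dout _); have:= leq_alpha3 (din _).
  rewrite !in_setU !in_setI !in_setD (negPf vS) (negPf uS) uC (negPf vC) !andbF /=.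
  rewrite -cS !card_exchange -(cardsID (branch e v u) S).
  rewrite -(cardsID (branch e v u) S') leq_add2r leq_add2l.
  by move=> /(_ isT) le_in /(_ isT) le_out; apply: leq_add.
split=> [[[S /andP[dS /eqP cS] vS] [S' /andP[dS' /eqP cS'] vS']] | [u]]; last first.
  exact: critical_edge_flexible.
have leSS' : #|S| <= #|S'| by rewrite cS cS'.
have conn_v x : connect e x v by [].
have [u e_vu ltSS'] := branch_pigeonhole sym_e irr_e conn_v leSS' vS vS'.
exists u; rewrite /critical_edge e_vu andTb.
have d0 := dissociation_set_delete v u dS; have d0' := dissociation_set_delete v u dS'.
(* The exchange keeps [v] and may contain [u], so it is used only after deletion of the edge. *)
apply: leq_trans (leq_alpha3 (exch v u S' S e_vu d0' d0)).
by rewrite card_exchange -cS -(cardsID (branch e v u) S) ltn_add2r.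
Qed.
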